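(* Let $G=(V,E)$ be a finite simple graph of class two and let $C\subseteq V$ be a minimum vertex cover of $G$. Then for every nonempty independent set $A\subseteq C$ we have $|N_{V-C}(A)|>2|A|$.
   Context: All graphs are finite and simple. For $X\subseteq V$, $N(X)$ is the union of neighborhoods of vertices of $X$ and $N_S(X)=N(X)\cap S$. $\beta(G)$ is the size of a minimum vertex cover. Alcuin problem: the vertices of $G$ are items initially on the left bank of a river; a man with a boat of capacity $b$ (a positive integer) must carry them all to the right bank so that no two adjacent vertices are ever left together on a bank. Formally, a feasible schedule for capacity $b$ is a sequence of triples $(L_k,B_k,R_k)$, $k=1,\dots,s$, $s$ odd, such that: each triple is a partition of $V$; $L_k$ and $R_k$ are independent sets; $|B_k|\le b$; $L_1\cup B_1=V$; $B_s\cup R_s=V$; for even $k$, $L_k=L_{k-1}$ and $B_k\cup R_k=B_{k-1}\cup R_{k-1}$; for odd $k\ge 3$, $R_k=R_{k-1}$ and $B_k\cup L_k=B_{k-1}\cup L_{k-1}$. The Alcuin number $c(G)$ is the least positive integer $b$ for which a feasible schedule exists. One always has $\beta(G)\le c(G)\le \beta(G)+1$; $G$ is of class one if $c(G)=\beta(G)$ and of class two if $c(G)=\beta(G)+1$. *)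

(* Defs.v *)
From mathcomp Require Import all_boot.

Set Implicit Arguments.
Unset Strict Implicit.
Unset Printing Implicit Defensive.

(* A finite simple graph is a symmetric irreflexive relation
   [e : rel T] on a finite vertex type [T]; these two properties are hypotheses
   of the theorems, not of the definitions below. *)

Section Graph.

Variables (T : finType) (e : rel T).
Implicit Types (A C S X : {set T}).

Definition neighborhood X : {set T} := \bigcup_(x in X) [set y | e x y].

Definition neighborhood_in S X : {set T} := neighborhood X :&: S.

Definition independent A : bool := [forall x in A, forall y in A, ~~ e x y].

Definition vertex_cover C : bool :=
  [forall x, forall y, e x y ==> (x \in C) || (y \in C)].

(* The default candidate [setT] is always a vertex cover. *)
Definition cover_number : nat := #|[arg min_(C < setT | vertex_cover C) #|C|]|.

Definition min_vertex_cover C : Prop :=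
  vertex_cover C /\ #|C| = cover_number.

(* [partition] of [finset] forbids empty blocks, which are allowed here. *)
Definition tripartition (L B R : {set T}) : Prop :=
  [/\ L :|: B :|: R = [set: T],
      [disjoint L & B], [disjoint L & R] & [disjoint B & R]].

(* Only the values of [L], [B], [R] at the indices 1, ..., s matter. *)
Record feasible_schedule (b s : nat) (L B R : nat -> {set T}) : Prop :=
  FeasibleSchedule {
    schedule_odd : odd s;
    schedule_partition :
      forall k, 1 <= k <= s -> tripartition (L k) (B k) (R k);
    schedule_independent :
      forall k, 1 <= k <= s -> independent (L k) /\ independent (R k);
    schedule_capacity : forall k, 1 <= k <= s -> #|B k| <= b;
    schedule_first : L 1 :|: B 1 = [set: T];
    schedule_last : B s :|: R s = [set: T];
    schedule_even : forall k, 2 <= k <= s -> ~~ odd k ->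
      L k = L k.-1 /\ B k :|: R k = B k.-1 :|: R k.-1;
    schedule_odd_step : forall k, 3 <= k <= s -> odd k ->
      R k = R k.-1 /\ B k :|: L k = B k.-1 :|: L k.-1
  }.

Definition feasible (b : nat) : Prop :=
  exists (s : nat) (L B R : nat -> {set T}), feasible_schedule b s L B R.

(* The least such capacity is given as a predicate, since [feasible] is not
   boolean; minimality makes it unique. *)
Definition is_alcuin_number (c : nat) : Prop :=
  [/\ 0 < c, feasible c & forall b, 0 < b -> feasible b -> c <= b].

Definition class_two : Prop := is_alcuin_number cover_number.+1.

End Graph.

(* Main.v *)
(** If [|N_{V-C}(A)| <= 2|A|], the capacity [|C|] suffices, against class two.
    Put [S = V - C], and split [N = N_S(A)] into [N1] and [N2] of size at most
    [|A|].  Ferry [C] over and leave [A] on the right bank; from then on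
    [C - A] stays in the boat, which keeps [|A|] free places.  Bring the
    vertices of [S - N] over one at a time, then [N1], which is exchanged on
    the right bank for [A].  Back on the left bank, exchange [A] for [N2], bring
    [N2] over, and finally return for [A]. *)

Require Import Defs.
From mathcomp Require Import all_boot.

Set Implicit Arguments.
Unset Strict Implicit.
Unset Printing Implicit Defensive.

Section River.

Variables (T : finType) (e : rel T).
Implicit Types (A C L R S X Z : {set T}).

(** * Independent sets and complements of vertex covers *)

Lemma independentP A :
  reflect {in A &, forall x y, ~~ e x y} (independent e A).
Proof.
apply: (iffP forall_inP) => [h x y xA yA | h x xA].
  exact: (forall_inP (h x xA)).
by apply/forall_inP => y yA; exact: h.
Qed.

Lemma independentS A X : X \subset A -> independent e A -> independent e X.
Proof.
move=> /subsetP sXA /independentP iA; apply/independentP => x y xX yX.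
by apply: iA; exact: sXA.
Qed.

Lemma independentU A X : symmetric e -> independent e A -> independent e X ->
  [disjoint neighborhood e A & X] -> independent e (A :|: X).
Proof.
move=> e_sym /independentP iA /independentP iX /pred0P dAX.
have nAX x y : x \in A -> y \in X -> ~~ e x y.
  move=> xA yX; apply/negP => exy; have /negP[] := dAX y.
  by rewrite /= yX andbT; apply/bigcupP; exists x => //; rewrite inE.
apply/independentP => x y; rewrite !inE => /orP[] xP /orP[] yP.
- exact: iA.
- exact: nAX.
- by rewrite e_sym; exact: nAX.
- exact: iX.
Qed.

Lemma independent_setC_cover C : vertex_cover e C -> independent e (~: C).
Proof.
move=> /forallP cC; apply/independentP => x y; rewrite !inE => xC yC.
by have /forallP/(_ y) := cC x; rewrite (negPf xC) (negPf yC) implybF.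
Qed.

(** * From single crossings to feasible schedules *)

(** The boat carries whatever is on neither bank. *)
Definition safe b L R : bool :=
  [&& independent e L, independent e R, [disjoint L & R] &
      #|~: (L :|: R)| <= b].

(** [crossing b right L R]: a man with a boat of capacity [b] can get under way
    with [L] and [R] on the banks, heading for the right bank iff [right]. *)
Inductive crossing b : bool -> {set T} -> {set T} -> Prop :=
| CrossingStart L : safe b L set0 -> crossing b true L set0
| CrossingBack L R R' :
    crossing b true L R -> safe b L R' -> crossing b false L R'
| CrossingForth L L' R :
    crossing b false L R -> safe b L' R -> crossing b true L' R.

(** A schedule with the boats left out. Since the three sets partition the vertices, each condition
    on a union with the boat reduces to one bank staying unchanged. *)
Definition banks_schedule b s (L R : nat -> {set T}) : Prop :=
  [/\ forall k, 1 <= k <= s -> safe b (L k) (R k), R 1 = set0,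
      forall k, 2 <= k <= s -> ~~ odd k -> L k = L k.-1
    & forall k, 2 <= k <= s -> odd k -> R k = R k.-1].

Lemma banks_schedule_extend b s (L R : nat -> {set T}) L' R' :
  0 < s -> banks_schedule b s L R -> safe b L' R' ->
  (if odd s then L s = L' else R s = R') ->
  banks_schedule b s.+1 (fun k => if k == s.+1 then L' else L k)
                        (fun k => if k == s.+1 then R' else R k).
Proof.
move=> s_gt0 [safeLR R1 Leven Rodd] safe' step; split.
- move=> k /andP[k_gt0]; rewrite leq_eqVlt ltnS.
  by case: eqP => //= _ k_le; apply: safeLR; rewrite k_gt0.
- by rewrite eqSS eq_sym (gtn_eqF s_gt0).
- move=> [|k] //= /andP[k_gt1]; rewrite ltnS eqSS negbK => k_le.
  have /negPf-> : k != s.+1 by rewrite ltn_eqF.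
  case: eqP => [-> | /eqP k_neq] odd_k; first by rewrite odd_k in step.
  by apply: (Leven k.+1) => /=; rewrite ?negbK // k_gt1 ltn_neqAle k_neq.
- move=> [|k] //= /andP[k_gt1]; rewrite ltnS eqSS => k_le.
  have /negPf-> : k != s.+1 by rewrite ltn_eqF.
  case: eqP => [-> | /eqP k_neq] odd_k; first by rewrite (negPf odd_k) in step.
  by apply: (Rodd k.+1) => //; rewrite k_gt1 ltn_neqAle k_neq.
Qed.

(** A derivation of [crossing] is read as the list of its states; the parity of its length records
    the direction. *)
Lemma crossing_schedule b right L R : crossing b right L R ->
  exists s (Ls Rs : nat -> {set T}),
    [/\ 0 < s, odd s = right, banks_schedule b s Ls Rs, Ls s = L & Rs s = R].
Proof.
elim=> {right L R} [L safeL | L R R' _ IH safe' | L L' R _ IH safe'].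
- by exists 1, (fun=> L), (fun=> set0); split.
- have [s [Ls [Rs [s_gt0 odd_s sched Ls_s Rs_s]]]] := IH.
  exists s.+1, (fun k => if k == s.+1 then L else Ls k),
    (fun k => if k == s.+1 then R' else Rs k).
  rewrite eqxx /= odd_s; split=> //.
  by apply: banks_schedule_extend; rewrite ?odd_s.
- have [s [Ls [Rs [s_gt0 odd_s sched Ls_s Rs_s]]]] := IH.
  exists s.+1, (fun k => if k == s.+1 then L' else Ls k),
    (fun k => if k == s.+1 then R else Rs k).
  rewrite eqxx /= odd_s; split=> //.
  by apply: banks_schedule_extend; rewrite ?odd_s.
Qed.

(** Heading right with an empty left bank is the last triple of a schedule. The boats are recovered
    as complements of the two banks. *)
Lemma crossing_feasible b R : crossing b true set0 R -> feasible e b.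
Proof.
case/crossing_schedule => s [Ls [Rs [s_gt0 odd_s sched Ls_s Rs_s]]].
have [safeLR R1 Leven Rodd] := sched.
have dLR k x : 1 <= k <= s -> x \in Ls k -> (x \in Rs k) = false.
  move=> /safeLR/and4P[_ _ /pred0P/(_ x)/= dx _] xL.
  by rewrite xL in dx.
exists s, Ls, (fun k => ~: (Ls k :|: Rs k)), Rs; split=> //.
- move=> k ks; split.
  + by apply/setP=> x; rewrite !inE; case: (x \in Ls k); case: (x \in Rs k).
  + by apply/pred0P=> x; rewrite /= !inE; case: (x \in Ls k).
  + by case/and4P: (safeLR k ks).
  + by apply/pred0P=> x; rewrite /= !inE; case: (x \in Rs k); rewrite ?orbT ?andbF.
- by move=> k /safeLR/and4P[].
- by move=> k /safeLR/and4P[].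
- by rewrite R1 setU0 setUCr.
- by rewrite Ls_s set0U setUC setUCr.
(* Disjointness of the banks makes boat and right bank the complement of the left bank, so an
   unchanged [Ls] gives the required equality of unions. *)
- have BR k : 1 <= k <= s -> ~: (Ls k :|: Rs k) :|: Rs k = ~: Ls k.
    move=> ks; apply/setP=> x; rewrite !inE; have := dLR k x ks.
    by case: (x \in Ls k) => [->|] //; case: (x \in Rs k).
  move=> [|[|k]] // /andP[_ ks] even_k; have Lk := Leven k.+2 ks even_k.
  by split=> //; rewrite !BR /= ?Lk // ltnW.
- have BL k : 1 <= k <= s -> ~: (Ls k :|: Rs k) :|: Ls k = ~: Rs k.
    move=> ks; apply/setP=> x; rewrite !inE; have := dLR k x ks.
    by case: (x \in Ls k) => [->|] //; case: (x \in Rs k).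
  move=> [|[|k]] // /andP[_ ks] odd_k; have Rk := Rodd k.+2 ks odd_k.
  by split=> //; rewrite !BL /= ?Rk // ltnW.
Qed.

(** * Ferrying everything with capacity [#|C|] *)

Lemma split_card_le_double X n : #|X| <= 2 * n ->
  exists2 Z : {set T}, Z \subset X & #|Z| <= n /\ #|X :\: Z| <= n.
Proof.
move=> X_le; have [X_len | /ltnW n_le] := leqP #|X| n.
  by exists X => //; rewrite setDv cards0.
have /card_geqP[s [s_uniq s_size sX]] := n_le.
exists [set x in s]; first by apply/subsetP=> x; rewrite inE; exact: sX.
have card_s : #|[set x in s]| = n by rewrite cardsE (card_uniqP s_uniq).
split; first by rewrite card_s.
have /setIidPr XI : [set x in s] \subset X.
  by apply/subsetP=> x; rewrite inE; exact: sX.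
by rewrite cardsD XI card_s leq_subLR addnn -mul2n.
Qed.

Section Cover.

Variables C A : {set T}.
Hypotheses (e_sym : symmetric e) (C_cover : vertex_cover e C).
Hypotheses (A_neq0 : A != set0) (A_indep : independent e A).
Hypothesis A_sub_C : A \subset C.

Let N := neighborhood_in e (~: C) A.

(** [Z] bounds the load carried besides [C :\: A]: the boat lies in [(C :\: A) :|: Z], and
    [#|C :\: A| + #|A| = #|C|]. *)
Lemma safe_cover Z L R : #|Z| <= #|A| -> independent e L -> independent e R ->
    (forall x, ~~ ((x \in L) && (x \in R))) ->
    (forall x, [|| x \in L, x \in R, x \in C :\: A | x \in Z]) ->
  safe #|C| L R.
Proof.
move=> Z_le iL iR dLR cov; rewrite /safe iL iR /=; apply/andP; split.
  by apply/pred0P=> x; apply/negbTE/dLR.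
have sub : ~: (L :|: R) \subset (C :\: A) :|: Z.
  apply/subsetP=> x; have := cov x; rewrite !inE.
  by case: (x \in L); case: (x \in R).
apply: leq_trans (subset_leq_card sub) _.
apply: leq_trans (leq_card_setU _ _) _.
rewrite -(cardsID A C) (setIidPr A_sub_C) addnC leq_add2r.
exact: Z_le.
Qed.

Lemma independent_far : independent e (A :|: (~: C :\: N)).
Proof.
apply: independentU => //.
  exact: independentS (subsetDl _ _) (independent_setC_cover C_cover).
apply/pred0P=> x; rewrite /= /N !inE.
by case: (x \in neighborhood e A); case: (x \in C).
Qed.

Let subA x : x \in A -> x \in C. Proof. exact: (subsetP A_sub_C). Qed.

Let subN x : x \in N -> x \notin C.
Proof. by rewrite /N !inE => /andP[]. Qed.

(** Induction on [#|X|], one round trip per vertex. No vertex of [X] has a neighbour in [A], so the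
    two may share the right bank while [C :\: A] stays in the boat. *)
Lemma crossing_far X : X \subset ~: C :\: N ->
  crossing #|C| false (~: C :\: X) (A :|: X).
Proof.
have iS := independent_setC_cover C_cover.
move: {2}#|X| (erefl #|X|) => n; elim: n X => [|n IH] X.
  move/cards0_eq=> -> _; rewrite setD0 setU0.
  (* The first crossing carries all of [C]; then [A] is put ashore on the right. *)
  apply: (@CrossingBack _ _ set0).
    apply: CrossingStart; apply: (@safe_cover A) => //.
    - by apply/independentP=> x y; rewrite inE.
    - by move=> x; rewrite !inE andbF.
    - by move=> x; rewrite !inE; case: (x \in C); case: (x \in A).
  apply: (@safe_cover set0) => //; rewrite ?cards0 //.
  - by move=> x; rewrite !inE; have := @subA x; case: (x \in A) => [->|];
      rewrite ?andbF.
  - by move=> x; rewrite !inE; case: (x \in C); case: (x \in A).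
move=> X_card X_sub.
have [x0 x0X] : exists x, x \in X by apply/card_gt0P; rewrite X_card.
have X'_sub : X :\ x0 \subset ~: C :\: N.
  exact: subset_trans (subsetDl _ _) X_sub.
have cross' : crossing #|C| false (~: C :\: (X :\ x0)) (A :|: X :\ x0).
  by apply: IH => //; move: X_card; rewrite (cardsD1 x0) x0X => -[].
have iL : independent e (~: C :\: X) by exact: independentS (subsetDl _ _) iS.
have X_notC x : x \in X -> x \notin C.
  by move=> /(subsetP X_sub); rewrite !inE => /andP[].
apply: (@CrossingBack _ _ (A :|: X :\ x0)).
  apply: CrossingForth cross' _; apply: (@safe_cover [set x0]) => //.
  (* One free place for [x0] exists because [A] is nonempty. *)
  - by rewrite cards1 card_gt0.
  - exact: independentS (setUS _ X'_sub) independent_far.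
  - move=> x; rewrite !inE; have := @subA x.
    by case: (x \in A) => [->|]; case: (x \in X); rewrite ?andbF.
  - move=> x; rewrite !inE.
    by case: (x \in C); case: (x \in X); case: (x \in A); case: (x == x0).
apply: (@safe_cover set0) => //; rewrite ?cards0 //.
- exact: independentS (setUS _ X_sub) independent_far.
- move=> x; rewrite !inE; have := @subA x.
  by case: (x \in A) => [->|]; case: (x \in X); rewrite ?andbF.
- by move=> x; rewrite !inE; case: (x \in C); case: (x \in X); case: (x \in A).
Qed.

Lemma crossing_cover : #|N| <= 2 * #|A| ->
  crossing #|C| true set0 (~: C).
Proof.
case/split_card_le_double => N1 N1_sub [N1_le N2_le].
have iS := independent_setC_cover C_cover.
have i0 : independent e set0 by apply/independentP=> x y; rewrite inE.
have subN1 x : x \in N1 -> x \in N by exact: (subsetP N1_sub).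
have iN2 : independent e (N :\: N1).
  apply: (independentS _ iS); apply/subsetP=> x; rewrite in_setD in_setC.
  by case/andP=> _ /subN.
have iR : independent e ((~: C :\: N) :|: N1).
  apply: (independentS _ iS); apply/subsetP=> x.
  by rewrite in_setU in_setD !in_setC => /orP[/andP[] | /subN1/subN].
have start : crossing #|C| false (~: C :\: (~: C :\: N)) (A :|: (~: C :\: N)).
  exact: crossing_far.
(* Every remaining safety condition is a Boolean identity in the memberships
   of [x] in [A], [C], [N] and [N1]. *)
have cases (P : bool -> bool -> bool -> bool -> bool) x :
    P true true false false -> P false true false false ->
    P false false true true -> P false false true false ->
    P false false false false ->
  P (x \in A) (x \in C) (x \in N) (x \in N1).
  (* [A] inside [C], [N] outside [C] and [N1] inside [N] leave five of the sixteen membership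
     patterns. *)
  move: (@subA x) (@subN x) (subN1 x).
  case: (x \in A) => [->|_] //.
    by case: (x \in N) => [/(_ isT)|_] //; case: (x \in N1) => // /(_ isT).
  case: (x \in C) => [|_].
    by case: (x \in N) => [/(_ isT)|_] //; case: (x \in N1) => // /(_ isT).
  by case: (x \in N); case: (x \in N1) => // /(_ isT).
have far_to_N1 : crossing #|C| true (N :\: N1) (A :|: (~: C :\: N)).
  apply: CrossingForth start _; apply: (@safe_cover N1) => //.
  - exact: independent_far.
  - move=> x; rewrite !(in_setU, in_setD, in_setC).
    by apply: (cases (fun a c n n1 => ~~ ((~~ n1 && n) && (a || (~~ n && ~~ c))))).
  - move=> x; rewrite !(in_setU, in_setD, in_setC).
    by apply: (cases (fun a c n n1 =>
      [|| ~~ n1 && n, a || (~~ n && ~~ c), ~~ a && c | n1])).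
(* With [A] back in the boat, the right bank lies in [~: C] and is independent although [N1]
   consists of neighbours of [A]. *)
have with_cover : crossing #|C| false (N :\: N1) ((~: C :\: N) :|: N1).
  apply: CrossingBack far_to_N1 _; apply: (@safe_cover A) => //.
  - move=> x; rewrite !(in_setU, in_setD, in_setC).
    by apply: (cases (fun a c n n1 => ~~ ((~~ n1 && n) && ((~~ n && ~~ c) || n1)))).
  - move=> x; rewrite !(in_setU, in_setD, in_setC).
    by apply: (cases (fun a c n n1 =>
      [|| ~~ n1 && n, (~~ n && ~~ c) || n1, ~~ a && c | a])).
have with_N2 : crossing #|C| true A ((~: C :\: N) :|: N1).
  apply: CrossingForth with_cover _; apply: (@safe_cover (N :\: N1)) => //.
  - move=> x; rewrite !(in_setU, in_setD, in_setC).
    by apply: (cases (fun a c n n1 => ~~ (a && ((~~ n && ~~ c) || n1)))).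
  - move=> x; rewrite !(in_setU, in_setD, in_setC).
    by apply: (cases (fun a c n n1 =>
      [|| a, (~~ n && ~~ c) || n1, ~~ a && c | ~~ n1 && n])).
(* Unloading [N :\: N1] completes [~: C] on the right; only [C :\: A] remains in the boat, which
   leaves room for [A]. *)
have back_for_A : crossing #|C| false A (~: C).
  apply: CrossingBack with_N2 _; apply: (@safe_cover set0); rewrite ?cards0 //.
  - by move=> x; rewrite in_setC; apply: (cases (fun a c _ _ => ~~ (a && ~~ c))).
  - move=> x; rewrite !(in_setD, in_setC, in_set0).
    by apply: (cases (fun a c _ _ => [|| a, ~~ c, ~~ a && c | false])).
apply: CrossingForth back_for_A _; apply: (@safe_cover A) => //.
- by move=> x; rewrite in_set0.
- by move=> x; rewrite !inE; case: (x \in A); case: (x \in C).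
Qed.

End Cover.

End River.

(** * Contradiction with the Alcuin number of a class two graph *)

Theorem theorem2p4 (T : finType) (e : rel T)
    (e_sym : symmetric e) (e_irr : irreflexive e)
    (G_class_two : class_two e)
    (C : {set T}) (C_min : min_vertex_cover e C)
    (A : {set T}) (A_nonempty : A != set0) (A_indep : independent e A)
    (A_sub_C : A \subset C) :
  2 * #|A| < #|neighborhood_in e (~: C) A|.
Proof.
have [C_cover C_card] := C_min; rewrite ltnNge; apply/negP => N_le.
have feasible_C : feasible e #|C|.
  apply: crossing_feasible.
  exact: crossing_cover e_sym C_cover A_nonempty A_indep A_sub_C N_le.
(* Minimality of the Alcuin number concerns positive capacities only; [C] contains the nonempty
   [A]. *)
have C_gt0 : 0 < #|C|.
  by apply: leq_trans (subset_leq_card A_sub_C); rewrite card_gt0.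
have [_ _ /(_ _ C_gt0 feasible_C)] := G_class_two.
by rewrite C_card ltnn.
Qed.
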